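(* Let $A$ be the disk algebra $\mathcal{A}$ or the algebra $H^\infty$, and let $a\in A$. If the multiplication operator $M_a:A\to A$, $M_a(x)=ax$, has a non-zero recurrent vector $b$, then $M_a$ is recurrent.
   Context: $\mathcal{A}$ is the Banach algebra of functions analytic on the open unit disk $\mathbb{D}$ and continuous on $\overline{\mathbb{D}}$, and $H^\infty$ is the Banach algebra of bounded analytic functions on $\mathbb{D}$, both with the supremum norm. A vector $x$ is recurrent for a bounded operator $T$ on a Banach space $X$ if there is a strictly increasing sequence of positive integers $(k_n)$ with $T^{k_n}x\to x$. The operator $T$ is recurrent if for every nonempty open set $U\subset X$ there is a positive integer $k$ with $U\cap T^{-k}(U)\neq\emptyset$ (equivalently, the set of recurrent vectors for $T$ is dense in $X$). *)

(* Defs.v *)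
From HB Require Import structures.
From mathcomp Require Import all_boot all_order all_algebra.
From mathcomp Require Import complex.
From mathcomp Require Import all_classical all_reals all_analysis.

Set Implicit Arguments.
Unset Strict Implicit.
Unset Printing Implicit Defensive.
Import Order.TTheory GRing.Theory Num.Theory.
Import numFieldNormedType.Exports.
Local Open Scope classical_set_scope.
Local Open Scope ring_scope.

(* The topology and the norm on R[i] are only inferred through its
   numClosedFieldType structure. *)
Definition Cplx (R : realType) : numClosedFieldType := R[i].

Definition open_disk (R : realType) : set (Cplx R) := [set z | `|z| < 1].
Definition closed_disk (R : realType) : set (Cplx R) := [set z | `|z| <= 1].
Arguments open_disk : clear implicits.
Arguments closed_disk : clear implicits.

(* E is the domain of f; analytic_at is only used at z0 in the interior of E,
   where it says that f is the sum of a convergent power series near z0. *)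
Definition analytic_at (R : realType) (E : set (Cplx R)) (f : E -> Cplx R)
    (z0 : Cplx R) : Prop :=
  exists (c : nat -> Cplx R) (r : Cplx R), 0 < r /\
    forall z : E, `|\val z - z0| < r ->
      series (fun n => c n * (\val z - z0) ^+ n) @ \oo --> f z.

Definition disk_analytic (R : realType) (E : set (Cplx R)) (f : E -> Cplx R) :=
  forall z0, open_disk R z0 -> analytic_at f z0.

(* `|f z| is a nonnegative real in R[i]; complex.Re reads it in R. The supremum
   is meaningful for bounded f only. *)
Definition sup_norm (R : realType) (T : Type) (f : T -> Cplx R) : R :=
  sup (range (fun z => complex.Re `|f z|)).

Definition bounded_function (R : realType) (T : Type) (f : T -> Cplx R) :=
  exists M : R, forall z, `|f z| <= (M%:C)%C.

Section power_series.
Variable R : realType.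
Local Notation C := (Cplx R).
Variable E : set C.
Hypothesis DE : open_disk R `<=` E.
Implicit Types f g : E -> C.

Lemma C_real_pos (e : C) : 0 < e -> exists2 x : R, 0 < x & e = (x%:C)%C.
Proof.
move=> e0; exists (complex.Re e); last first.
  by rewrite RRe_real// gtr0_real.
by move: e0; rewrite ltcE => /andP[].
Qed.

Lemma C_geom0 (x : nat -> C) (K : C) : 0 < K ->
  (forall n, `|x n| <= K * 2^-1 ^+ n) -> x @ \oo --> (0 : C).
Proof.
move=> /C_real_pos[k k0 ->] xk; apply/cvgr0Pnorm_lt => _ /C_real_pos[e e0 ->].
near=> n; apply: le_lt_trans (xk n) _.
have -> : (2^-1 ^+ n : C) = ((2^-1 ^+ n)%:C)%C.
  by rewrite rmorphXn/= fmorphV/= rmorphMn/= rmorph1.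
rewrite -[X in X < _]rmorphM/= ltcR mulrC -ltr_pdivlMr//.
near: n.
have : (fun n : nat => (2^-1 : R) ^+ n) @ \oo --> (0 : R).
  by apply: cvg_expr; rewrite ger0_norm ?invr_ge0// invf_lt1// ltr1n.
move=> /cvgr0Pnorm_lt/(_ (e / k))[|N _ HN]; first exact: divr_gt0.
by exists N => // n Nn; have := HN n Nn; rewrite /= ger0_norm// exprn_ge0 ?invr_ge0.
Unshelve. all: by end_near. Qed.

Lemma analytic_cst (a : C) z0 : analytic_at (fun _ : E => a) z0.
Proof.
exists (fun n => if n == 0%N then a else 0), 1; split => // z _.
apply: cvg_near_cst; exists 1%N => // -[//|n] _.
rewrite /series /= big_nat_recl//= expr0 mulr1 big1_seq ?addr0// => i _.
by rewrite mul0r.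
Qed.

Lemma analytic_lin (a : C) f g z0 : analytic_at f z0 -> analytic_at g z0 ->
  analytic_at (a *: f + g : E -> C) z0.
Proof.
move=> [c [r [r0 fc]]] [d [s [s0 gd]]].
have [t [t0 tr ts]] : exists t, [/\ 0 < t, t <= r & t <= s].
  have [le|le] : r <= s \/ s <= r.
    by apply/orP; rewrite real_leVge ?gtr0_real.
  - by exists r.
  - by exists s.
exists (fun n => a * c n + d n), t; split => // z zt.
have -> : series (fun n => (a * c n + d n) * (\val z - z0) ^+ n) =
    (fun n => a * series (fun n => c n * (\val z - z0) ^+ n) n +
              series (fun n => d n * (\val z - z0) ^+ n) n).
  apply/funext => n; rewrite /series/= mulr_sumr -big_split/=.
  by apply: eq_bigr => i _; rewrite mulrDl mulrA.
apply: cvgD; last exact: (gd _ (lt_le_trans zt ts)).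
by apply: cvgM; [exact: cvg_cst|exact: (fc _ (lt_le_trans zt tr))].
Qed.

Lemma analytic_coef_bound f z0 (c : nat -> C) (r : C) : open_disk R z0 -> 0 < r ->
  (forall z : E, `|\val z - z0| < r ->
      series (fun n => c n * (\val z - z0) ^+ n) @ \oo --> f z) ->
  exists (rho M : C), [/\ 0 < rho, 0 < M, rho <= r &
    forall n w, `|w| <= rho / 8 -> `|c n * w ^+ n| <= M * 8^-1 ^+ n].
Proof.
move=> z0D r0 fc.
have d0 : 0 < 1 - `|z0| by rewrite subr_gt0.
have [t [t0 tr td]] : exists t, [/\ 0 < t, t <= r & t <= 1 - `|z0|].
  have [le|le] : r <= 1 - `|z0| \/ 1 - `|z0| <= r.
    by apply/orP; rewrite real_leVge ?gtr0_real.
  - by exists r.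
  - by exists (1 - `|z0|).
pose rho := t / 2.
have rho0 : 0 < rho by rewrite divr_gt0.
have rhot : rho < t by rewrite ltr_pdivrMr// ltr_pMr// ltr1n.
have zE : z0 + rho \in E.
  apply/mem_set/DE; rewrite /open_disk/=.
  apply: le_lt_trans (ler_normD _ _) _.
  by rewrite -ltrBrDl (gtr0_norm rho0) (lt_le_trans rhot).
pose z1 : E := exist (fun z => z \in E) _ zE.
have := fc z1; rewrite /= addrAC subrr add0r (gtr0_norm rho0).
move=> /(_ (lt_le_trans rhot tr)) cf.
have bnd : bounded_fun (fun n => c n * rho ^+ n).
  apply: cvg_seq_bounded; apply/cvg_ex; exists 0; apply: cvg_series_cvg_0.
  by apply/cvg_ex; exists (f z1).
have PF : ProperFilter (globally [set: nat]).
  exact: (@globally_properfilter _ setT 0%N).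
have [M MP] := (ex_bound _).1 bnd.
have {}MP n : `|c n * rho ^+ n| <= M by apply: MP.
exists rho, (M + 1); split => //.
- by rewrite (le_lt_trans (le_trans (normr_ge0 _) (MP 0%N)))// ltrDl.
- by rewrite (le_trans (ltW rhot)).
move=> n w wr; rewrite normrM normrX.
apply: (@le_trans _ _ (`|c n| * (rho / 8) ^+ n)).
  by apply: ler_wpM2l => //; rewrite lerXn2r// nnegrE// divr_ge0// ltW.
rewrite exprMn mulrA ler_wpM2r ?exprn_ge0 ?invr_ge0//.
rewrite (le_trans _ (_ : M <= _)) ?lerDl//.
by have := MP n; rewrite normrM normrX (gtr0_norm rho0).
Qed.

Lemma analytic_mul f g z0 : open_disk R z0 ->
  analytic_at f z0 -> analytic_at g z0 -> analytic_at (f * g : E -> C) z0.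
Proof.
move=> z0D [c [r [r0 fc]]] [d [s [s0 gd]]].
have [rho [M [rho0 M0 rhor cM]]] := analytic_coef_bound z0D r0 fc.
have [sig [L [sig0 L0 sigs dL]]] := analytic_coef_bound z0D s0 gd.
have [t [t0 tr ts]] : exists t, [/\ 0 < t, t <= rho / 8 & t <= sig / 8].
  have [le|le] : rho / 8 <= sig / 8 \/ sig / 8 <= rho / 8.
    by apply/orP; rewrite real_leVge ?gtr0_real ?divr_gt0.
  - by exists (rho / 8); rewrite divr_gt0.
  - by exists (sig / 8); rewrite divr_gt0.
exists (fun n => \sum_(j < n.+1) c j * d (n - j)%N), t; split => // z zt.
set w := _ - z0 in zt *.
have le8 (x : C) : 0 < x -> x / 8 <= x.
  by move=> x0; rewrite ler_pdivrMr// ler_peMr ?ler1n ?ltW.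
have Hf := fc z (lt_le_trans zt (le_trans tr (le_trans (le8 _ rho0) rhor))).
have Hg := gd z (lt_le_trans zt (le_trans ts (le_trans (le8 _ sig0) sigs))).
rewrite -/w in Hf Hg.
pose u n := c n * w ^+ n; pose v n := d n * w ^+ n.
have uM n : `|u n| <= M * 8^-1 ^+ n by apply: cM; rewrite (le_trans (ltW zt)).
have vL n : `|v n| <= L * 8^-1 ^+ n by apply: dL; rewrite (le_trans (ltW zt)).
pose q n := \sum_(j < n.+1) u j * v (n - j)%N.
have qE n : (\sum_(j < n.+1) c j * d (n - j)%N) * w ^+ n = q n.
  rewrite mulr_suml; apply: eq_bigr => j _.
  rewrite /u /v mulrACA; congr (_ * _); rewrite -exprD subnKC//.
  by rewrite -ltnS.
have -> : (fun n => (\sum_(j < n.+1) c j * d (n - j)%N) * w ^+ n) = q.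
  exact/funext.
pose P N := \poly_(i < N) u i; pose Q N := \poly_(i < N) v i.
have sumP N : series u N = (P N).[1].
  rewrite horner_poly /series/= big_mkord; apply: eq_bigr => i _.
  by rewrite expr1n mulr1.
have sumQ N : series v N = (Q N).[1].
  rewrite horner_poly /series/= big_mkord; apply: eq_bigr => i _.
  by rewrite expr1n mulr1.
have sPQ N : (size (P N * Q N)%R <= N + N)%N.
  apply: leq_trans (size_polyMleq _ _) _.
  apply: leq_trans (leq_pred _) _.
  by apply: leq_add; exact: size_poly.
have coefPQ N n : (n < N)%N -> (P N * Q N)`_n = q n.
  move=> nN; rewrite coefM; apply: eq_bigr => j _; rewrite !coef_poly.
  have jn : (j <= n)%N by rewrite -ltnS.
  by rewrite (leq_ltn_trans jn nN) (leq_ltn_trans (leq_subr _ _) nN).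
have boundPQ N n : `|(P N * Q N)`_n| <= (M * L) * 4^-1 ^+ n.
  rewrite coefM; apply: le_trans (ler_norm_sum _ _ _) _.
  apply: (@le_trans _ _ (\sum_(j < n.+1) (M * L) * 8^-1 ^+ n)).
    apply: ler_sum => j _; rewrite normrM !coef_poly.
    apply: (@le_trans _ _ ((M * 8^-1 ^+ j) * (L * 8^-1 ^+ (n - j)))).
      apply: ler_pM => //; case: ifP => _ //; rewrite normr0.
        by rewrite mulr_ge0 ?exprn_ge0 ?invr_ge0 ?ltW.
      by rewrite mulr_ge0 ?exprn_ge0 ?invr_ge0 ?ltW.
    by rewrite mulrACA -exprD subnKC// -ltnS.
  rewrite sumr_const card_ord -(mulr_natr (M * L * _)) -(mulrA (M * L)) ler_pM2l ?mulr_gt0//.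
  rewrite (_ : 8^-1 = 4^-1 * 2^-1 :> C); last first.
    by rewrite -invfM -natrM.
  rewrite exprMn -mulrA ler_piMr ?exprn_ge0 ?invr_ge0//.
  rewrite exprVn mulrC ler_pdivrMr ?exprn_gt0// mul1r -natrX ler_nat.
  exact: ltn_expl.
have step N : `|series q N - series u N * series v N| <= (M * L) * 2^-1 ^+ N.
  rewrite sumP sumQ -hornerM (horner_coef_wide _ (sPQ N)).
  rewrite -(big_mkord xpredT (fun i => (P N * Q N)`_i * 1 ^+ i)).
  rewrite (big_cat_nat _ (n := N)) ?leq_addr//=.
  have -> : \sum_(0 <= i < N) (P N * Q N)`_i * 1 ^+ i = series q N.
    rewrite /series/= big_nat [RHS]big_nat; apply: eq_bigr => i /andP[_ iN].
    by rewrite expr1n mulr1 coefPQ.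
  rewrite opprD addrA subrr add0r normrN.
  apply: le_trans (ler_norm_sum _ _ _) _.
  apply: (@le_trans _ _ (\sum_(N <= i < N + N) (M * L) * 4^-1 ^+ N)).
    rewrite big_nat [leRHS]big_nat; apply: ler_sum => i /andP[Ni _].
    rewrite expr1n mulr1 (le_trans (boundPQ _ _))// ler_pM2l ?mulr_gt0//.
    apply: ler_wiXn2l => //.
    by rewrite invf_le1// ler1n.
  rewrite sumr_const_nat addnK -(mulr_natr (M * L * _)) -(mulrA (M * L)) ler_pM2l ?mulr_gt0//.
  rewrite (_ : 4^-1 = 2^-1 * 2^-1 :> C); last by rewrite -invfM -natrM.
  rewrite exprMn -mulrA ler_piMr ?exprn_ge0 ?invr_ge0//.
  rewrite exprVn mulrC ler_pdivrMr ?exprn_gt0// mul1r -natrX ler_nat.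
  exact: ltnW (ltn_expl _ _).
have d0 : (fun N => series q N - series u N * series v N) @ \oo --> (0 : C).
  by apply: C_geom0 step; rewrite mulr_gt0.
have H := cvgD d0 (cvgM Hf Hg); rewrite add0r in H.
have qE' : series q = (fun N => series q N - series u N * series v N) +
                     (series u * series v : nat -> C).
  by apply/funext => N; rewrite [RHS]subrK.
have fgE : (f * g : E -> C) z = f z * g z by [].
rewrite fgE qE'.
exact: H.
Qed.

End power_series.

Section bounded_functions.
Variables (R : realType) (T : Type).
Local Notation C := (Cplx R).
Implicit Types f g : T -> C.

Lemma real_C (x : C) : x \is Num.real -> x = ((complex.Re x)%:C)%C.
Proof. by move=> /RRe_real ->. Qed.

Lemma norm_C (x : C) : `|x| = ((complex.Re `|x|)%:C)%C.
Proof. exact: real_C. Qed.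

Lemma bounded_cst (a : C) : bounded_function (fun _ : T => a).
Proof. by exists (complex.Re `|a|) => z; rewrite [leLHS]norm_C. Qed.

Lemma bounded_lin (a : C) f g : bounded_function f -> bounded_function g ->
  bounded_function (a *: f + g : T -> C).
Proof.
move=> [M fM] [L gL]; exists (complex.Re `|a| * M + L) => z.
rewrite rmorphD rmorphM/= -norm_C; apply: le_trans (ler_normD _ _) _.
by rewrite lerD// normrM ler_wpM2l.
Qed.

Lemma bounded_mul f g : bounded_function f -> bounded_function g ->
  bounded_function (f * g : T -> C).
Proof.
move=> [M fM] [L gL]; exists (M * L) => z.
by rewrite rmorphM/= normrM ler_pM.
Qed.

Variable t0 : T.

Lemma sup_norm_ub f z : bounded_function f -> `|f z| <= ((sup_norm f)%:C)%C.
Proof.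
move=> [M fM]; rewrite [leLHS]norm_C lecR; apply: ub_le_sup; last by exists z.
exists M => _ [y _ <-].
by have := fM y; rewrite [leLHS]norm_C lecR.
Qed.

Lemma sup_norm_le f (M : R) :
  (forall z, `|f z| <= (M%:C)%C) -> sup_norm f <= M.
Proof.
move=> fM; apply: ge_sup; first by exists (complex.Re `|f t0|); exists t0.
by move=> _ [y _ <-]; have := fM y; rewrite [leLHS]norm_C lecR.
Qed.

Lemma sup_norm_ge0 f : bounded_function f -> 0 <= sup_norm f.
Proof.
by move=> bf; rewrite -ler0c; apply: le_trans (sup_norm_ub t0 bf).
Qed.

Lemma sup_normD f g : bounded_function f -> bounded_function g ->
  sup_norm (f + g : T -> C) <= sup_norm f + sup_norm g.
Proof.
move=> bf bg; apply: sup_norm_le => z; rewrite rmorphD/=.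
by apply: le_trans (ler_normD _ _) _; rewrite lerD// sup_norm_ub.
Qed.

Lemma sup_norm0 f : bounded_function f -> sup_norm f = 0 -> f = 0.
Proof.
move=> bf f0; apply/funext => z; apply/eqP.
by have := sup_norm_ub z bf; rewrite f0 normr_le0.
Qed.

Lemma sup_normZ (a : C) f : bounded_function f ->
  ((sup_norm (a *: f : T -> C))%:C)%C = `|a| * ((sup_norm f)%:C)%C.
Proof.
move=> bf.
have le1 (b : C) (g : T -> C) : bounded_function g ->
    ((sup_norm (b *: g : T -> C))%:C)%C <= `|b| * ((sup_norm g)%:C)%C.
  move=> bg; rewrite [X in _ <= X * _]norm_C -rmorphM lecR; apply: sup_norm_le => z.
  by rewrite rmorphM/= -norm_C normrM ler_wpM2l// sup_norm_ub.
have baf : bounded_function (a *: f : T -> C).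
  by rewrite -[_ *: _]addr0; apply: bounded_lin => //; exact: bounded_cst.
apply/le_anti; rewrite le1//=.
have [->|a0] := eqVneq a 0.
  by rewrite normr0 mul0r ler0c; apply: sup_norm_ge0; rewrite scale0r; exact: bounded_cst.
have := le1 a^-1 (a *: f : T -> C) baf.
by rewrite scalerA mulVf// scale1r normfV mulrC ler_pdivlMr ?normr_gt0// mulrC.
Qed.

Lemma sup_normM f g : bounded_function f -> bounded_function g ->
  sup_norm (f * g : T -> C) <= sup_norm f * sup_norm g.
Proof.
move=> bf bg; apply: sup_norm_le => z; rewrite rmorphM/= normrM.
by apply: ler_pM => //; exact: sup_norm_ub.
Qed.

End bounded_functions.

Section closed_disk_compact.
Variable R : realType.
Local Notation C := (Cplx R).

Let g (p : R * R) : C := (p.1 +i* p.2)%C.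

Let g_continuous : continuous g.
Proof.
have -> : g = (fun p => (p.1 +i* 0)%C + 'i * (p.2 +i* 0)%C : C).
  by apply/funext => -[x y]; rewrite /g [LHS]complexE.
have re : continuous (fun x : R => (x +i* 0)%C : C).
  move=> x; apply/cvgrPdist_lt => e /C_real_pos[d d0 ->].
  near=> y; rewrite (_ : _ - _ = ((x - y)%:C)%C); last by rewrite rmorphB.
  rewrite normc_def/= expr0n/= addr0 sqrtr_sqr ltcR.
  by near: y; apply: cvgr_dist_lt.
move=> p.
have re1 : ((q.1 +i* 0)%C : C) @[q --> p] --> ((p.1 +i* 0)%C : C).
  by apply: (@continuous_comp _ _ _ fst (fun x : R => (x +i* 0)%C : C) p _ (re _)); exact: cvg_fst.
have re2 : ((q.2 +i* 0)%C : C) @[q --> p] --> ((p.2 +i* 0)%C : C).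
  by apply: (@continuous_comp _ _ _ snd (fun x : R => (x +i* 0)%C : C) p _ (re _)); exact: cvg_snd.
exact: (cvgD re1 (cvgM (cvg_cst _) re2)).
Unshelve. all: by end_near. Qed.

Lemma closed_disk_closed : closed (closed_disk R).
Proof.
rewrite -[closed_disk R]setCK; apply: open_closedC.
rewrite openE => z /negP; rewrite /closed_disk/= -real_ltNge// => z1.
apply/nbhs_ballP; exists (`|z| - 1); first by rewrite /= subr_gt0.
move=> w; rewrite -ball_normE/= => zw; apply/negP; rewrite -real_ltNge//.
rewrite ltrBrDr -ltrBrDl in zw; apply: lt_le_trans zw _.
by rewrite lerBlDl -{1}(subrK w z) ler_normD.
Qed.

Lemma closed_disk_compact : compact (closed_disk R).
Proof.
have sq : compact (`[(-1 : R), 1] `*` `[(-1 : R), 1]).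
  by apply: compact_setX; exact: segment_compact.
have gsq := continuous_compact (continuous_subspaceT g_continuous) sq.
apply: (subclosed_compact closed_disk_closed gsq).
move=> z z1; exists (complex.Re z, complex.Im z); last by case: z {z1}.
have bnd (x : C) : `|x| <= 1 -> complex.Re x \in `[-1, 1].
  move=> x1; rewrite in_itv/= -ler_norml -lecR.
  exact: le_trans (normc_ge_Re _) x1.
split; rewrite /=; first exact: bnd.
have := bnd (- ('i * z)); rewrite normrN normrM normCi mul1r => /(_ z1).
by case: z {z1} => a b /=; rewrite !mul0r mul1r sub0r opprK.
Qed.

Lemma continuous_bounded (f : closed_disk R -> C) :
  continuous f -> bounded_function f.
Proof.
move=> /subspace_valL_continuousP cf.
have /continuous_compact/(_ closed_disk_compact) cK := cf.
have hc : continuous (fun w : C => complex.Re `|w| : R).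
  move=> w; apply: (@cvgrPdist_lt R R^o C (nbhs w) _ _ _).2 => e e0.
  have := @nbhsx_ballx C C w (e%:C)%C; rewrite ltcR => /(_ e0).
  apply: filterS => y; rewrite -ball_normE/= => wy; rewrite -ltcR; apply: le_lt_trans wy.
  apply: le_trans (ler_dist_dist _ _).
  have -> : complex.Re `|w| - complex.Re `|y| = complex.Re (`|w| - `|y|).
    by case: `|w| => a1 a2; case: `|y|.
  exact: normc_ge_Re.
have := @continuous_compact _ _ _ _ (continuous_subspaceT hc) cK.
move=> /(@compact_bounded R R^o)[M [Mr MP]].
exists (M + 1) => z; rewrite [leLHS]norm_C lecR.
apply: le_trans (ler_norm _) _; apply: (MP (M + 1)); first by rewrite ltrDl.
exists (f z) => //; exists (\val z); first exact: set_valP.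
by rewrite -[in RHS](valLK point f).
Qed.

End closed_disk_compact.

Lemma open_disk0 (R : realType) : (0 : Cplx R) \in open_disk R.
Proof. by apply/mem_set; rewrite /open_disk/= normr0. Qed.

Lemma closed_disk0 (R : realType) : (0 : Cplx R) \in closed_disk R.
Proof. by apply/mem_set; rewrite /closed_disk/= normr0. Qed.

Lemma open_closed_disk (R : realType) : open_disk R `<=` closed_disk R.
Proof. by move=> z /ltW. Qed.

Definition disk_pt (R : realType) : open_disk R :=
  exist (fun z => z \in open_disk R) 0 (open_disk0 R).
Definition cdisk_pt (R : realType) : closed_disk R :=
  exist (fun z => z \in closed_disk R) 0 (closed_disk0 R).

Definition Hinf_pred (R : realType) : {pred (open_disk R -> Cplx R)} :=
  fun f => `[< disk_analytic f /\ bounded_function f >].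

(* Continuity is for the subspace topology of the closed disk; boundedness
   follows, see continuous_bounded. *)
Definition disk_algebra_pred (R : realType) : {pred (closed_disk R -> Cplx R)} :=
  fun f => `[< disk_analytic f /\ continuous f >].
Arguments Hinf_pred : clear implicits.
Arguments disk_algebra_pred : clear implicits.

Section closedness.
Variable R : realType.
Local Notation C := (Cplx R).

Lemma disk_analytic_mul (E : set C) (f g : E -> C) : open_disk R `<=` E ->
  disk_analytic f -> disk_analytic g -> disk_analytic (f * g : E -> C).
Proof. by move=> DE fa ga z Dz; apply: analytic_mul; [| |exact: fa|exact: ga]. Qed.

Lemma disk_analytic_lin (E : set C) (a : C) (f g : E -> C) :
  disk_analytic f -> disk_analytic g -> disk_analytic (a *: f + g : E -> C).
Proof. by move=> fa ga z Dz; apply: analytic_lin; [exact: fa|exact: ga]. Qed.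

Lemma Hinf_closed1 : 1 \in Hinf_pred R.
Proof.
apply/asboolP; split; last exact: bounded_cst.
by move=> z _; exact: analytic_cst.
Qed.

Lemma Hinf_closedM : GRing.mulr_2closed (Hinf_pred R).
Proof.
move=> f g /asboolP[fa fb] /asboolP[ga gb]; apply/asboolP.
by split; [exact: disk_analytic_mul|exact: bounded_mul].
Qed.

Lemma Hinf_closed_lin (a : C) f g : f \in Hinf_pred R -> g \in Hinf_pred R ->
  a *: f + g \in Hinf_pred R.
Proof.
move=> /asboolP[fa fb] /asboolP[ga gb]; apply/asboolP.
by split; [exact: disk_analytic_lin|exact: bounded_lin].
Qed.

Lemma disk_algebra_closed1 : 1 \in disk_algebra_pred R.
Proof.
apply/asboolP; split; last exact: (@cst_continuous _ _ (1 : C)).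
by move=> z _; exact: analytic_cst.
Qed.

Lemma disk_algebra_closedM : GRing.mulr_2closed (disk_algebra_pred R).
Proof.
move=> f g /asboolP[fa fc] /asboolP[ga gc]; apply/asboolP; split.
  exact: disk_analytic_mul (@open_closed_disk R) fa ga.
by move=> z; exact: (cvgM (fc z) (gc z)).
Qed.

Lemma disk_algebra_closed_lin (a : C) f g :
  f \in disk_algebra_pred R -> g \in disk_algebra_pred R ->
  a *: f + g \in disk_algebra_pred R.
Proof.
move=> /asboolP[fa fc] /asboolP[ga gc]; apply/asboolP; split.
  exact: disk_analytic_lin.
by move=> z; exact: (cvgD (cvgM (cvg_cst a) (fc z)) (gc z)).
Qed.

End closedness.

Lemma lin_subring_closed (R : realType) (T : Type)
    (S : {pred (T -> Cplx R)}) :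
  1 \in S -> GRing.mulr_2closed S ->
  (forall (a : Cplx R) f g, f \in S -> g \in S -> a *: f + g \in S) ->
  GRing.subring_closed S.
Proof.
move=> S1 SM SL; split=> // f g fS gS.
by rewrite addrC -scaleN1r; exact: SL.
Qed.

Lemma lin_subsemimod_closed (R : realType) (T : Type)
    (S : {pred (T -> Cplx R)}) : 1 \in S ->
  (forall (a : Cplx R) f g, f \in S -> g \in S -> a *: f + g \in S) ->
  GRing.subsemimod_closed S.
Proof.
move=> S1 SL; have S0 : 0 \in S.
  by rewrite -(addNr (1 : T -> Cplx R)) -scaleN1r SL.
split; first split=> // f g fS gS.
  by rewrite -[f]scale1r SL.
by move=> a f fS; rewrite -[_ *: _]addr0 SL.
Qed.

Record Hinf (R : realType) := MkHinf {
  Hinf_fun :> open_disk R -> Cplx R ;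
  Hinf_funP : Hinf_fun \in Hinf_pred R }.

Record disk_algebra (R : realType) := MkDiskAlgebra {
  disk_algebra_fun :> closed_disk R -> Cplx R ;
  disk_algebra_funP : disk_algebra_fun \in disk_algebra_pred R }.

HB.instance Definition _ (R : realType) := [isSub for @Hinf_fun R].
HB.instance Definition _ (R : realType) := [Choice of Hinf R by <:].
HB.instance Definition _ (R : realType) :=
  GRing.SubChoice_isSubComPzRing.Build _ (Hinf_pred R) (Hinf R)
    (lin_subring_closed (Hinf_closed1 R) (@Hinf_closedM R) (@Hinf_closed_lin R)).
HB.instance Definition _ (R : realType) :=
  GRing.SubZmodule_isSubLmodule.Build (Cplx R) _ (Hinf_pred R) (Hinf R)
    (lin_subsemimod_closed (Hinf_closed1 R) (@Hinf_closed_lin R)).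

HB.instance Definition _ (R : realType) := [isSub for @disk_algebra_fun R].
HB.instance Definition _ (R : realType) := [Choice of disk_algebra R by <:].
HB.instance Definition _ (R : realType) :=
  GRing.SubChoice_isSubComPzRing.Build _ (disk_algebra_pred R) (disk_algebra R)
    (lin_subring_closed (disk_algebra_closed1 R) (@disk_algebra_closedM R) (@disk_algebra_closed_lin R)).
HB.instance Definition _ (R : realType) :=
  GRing.SubZmodule_isSubLmodule.Build (Cplx R) _ (disk_algebra_pred R) (disk_algebra R)
    (lin_subsemimod_closed (disk_algebra_closed1 R) (@disk_algebra_closed_lin R)).

Section Hinf_normed.
Variable R : realType.
Implicit Types x y : Hinf R.

Lemma Hinf_bounded x : bounded_function x.
Proof. by case: x => f /= /asboolP[]. Qed.

Definition Hinf_norm x : Cplx R := ((sup_norm x)%:C)%C.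

Lemma Hinf_normD x y : Hinf_norm (x + y) <= Hinf_norm x + Hinf_norm y.
Proof.
rewrite /Hinf_norm -rmorphD lecR.
exact: (sup_normD (disk_pt R) (Hinf_bounded x) (Hinf_bounded y)).
Qed.

Lemma Hinf_normZ (a : Cplx R) x : Hinf_norm (a *: x) = `|a| * Hinf_norm x.
Proof. exact: (sup_normZ (disk_pt R) a (Hinf_bounded x)). Qed.

Lemma Hinf_norm0 x : Hinf_norm x = 0 -> x = 0.
Proof.
move=> /complexI /(sup_norm0 (Hinf_bounded x)) x0.
by apply: val_inj.
Qed.

Lemma Hinf_oner_neq0 : (1 : Hinf R) != 0.
Proof.
apply/eqP => /(congr1 (fun x : Hinf R => x (disk_pt R))) /eqP.
by rewrite /= oner_eq0.
Qed.

Lemma Hinf_scalerAl (a : Cplx R) x y : a *: (x * y) = (a *: x) * y.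
Proof. by apply: val_inj; apply/funext => z; exact: mulrA. Qed.

End Hinf_normed.

HB.instance Definition _ (R : realType) :=
  GRing.PzSemiRing_isNonZero.Build (Hinf R) (Hinf_oner_neq0 R).
HB.instance Definition _ (R : realType) :=
  GRing.Lmodule_isLalgebra.Build (Cplx R) (Hinf R) (@Hinf_scalerAl R).
HB.instance Definition _ (R : realType) :=
  GRing.Lalgebra_isComAlgebra.Build (Cplx R) (Hinf R).
HB.instance Definition _ (R : realType) :=
  @Lmodule_isNormed.Build (Cplx R) (Hinf R) (@Hinf_norm R)
    (@Hinf_normD R) (@Hinf_normZ R) (@Hinf_norm0 R).

Lemma Hinf_normE (R : realType) (x : Hinf R) : `|x| = ((sup_norm x)%:C)%C.
Proof. by []. Qed.

Lemma Hinf_normM (R : realType) (x y : Hinf R) : `|x * y| <= `|x| * `|y|.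
Proof.
rewrite !Hinf_normE -rmorphM lecR.
exact: (sup_normM (disk_pt R) (Hinf_bounded x) (Hinf_bounded y)).
Qed.

Section disk_algebra_normed.
Variable R : realType.
Implicit Types x y : disk_algebra R.

Lemma disk_algebra_bounded x : bounded_function x.
Proof. by case: x => f /= /asboolP[_ /continuous_bounded]. Qed.

Definition disk_algebra_norm x : Cplx R := ((sup_norm x)%:C)%C.

Lemma disk_algebra_normD x y :
  disk_algebra_norm (x + y) <= disk_algebra_norm x + disk_algebra_norm y.
Proof.
rewrite /disk_algebra_norm -rmorphD lecR.
exact: (sup_normD (cdisk_pt R) (disk_algebra_bounded x) (disk_algebra_bounded y)).
Qed.

Lemma disk_algebra_normZ (a : Cplx R) x :
  disk_algebra_norm (a *: x) = `|a| * disk_algebra_norm x.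
Proof. exact: (sup_normZ (cdisk_pt R) a (disk_algebra_bounded x)). Qed.

Lemma disk_algebra_norm0 x : disk_algebra_norm x = 0 -> x = 0.
Proof.
move=> /complexI /(sup_norm0 (disk_algebra_bounded x)) x0.
by apply: val_inj.
Qed.

Lemma disk_algebra_oner_neq0 : (1 : disk_algebra R) != 0.
Proof.
apply/eqP => /(congr1 (fun x : disk_algebra R => x (cdisk_pt R))) /eqP.
by rewrite /= oner_eq0.
Qed.

Lemma disk_algebra_scalerAl (a : Cplx R) x y : a *: (x * y) = (a *: x) * y.
Proof. by apply: val_inj; apply/funext => z; exact: mulrA. Qed.

End disk_algebra_normed.

HB.instance Definition _ (R : realType) :=
  GRing.PzSemiRing_isNonZero.Build (disk_algebra R) (disk_algebra_oner_neq0 R).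
HB.instance Definition _ (R : realType) :=
  GRing.Lmodule_isLalgebra.Build (Cplx R) (disk_algebra R)
    (@disk_algebra_scalerAl R).
HB.instance Definition _ (R : realType) :=
  GRing.Lalgebra_isComAlgebra.Build (Cplx R) (disk_algebra R).
HB.instance Definition _ (R : realType) :=
  @Lmodule_isNormed.Build (Cplx R) (disk_algebra R) (@disk_algebra_norm R)
    (@disk_algebra_normD R) (@disk_algebra_normZ R) (@disk_algebra_norm0 R).

Lemma disk_algebra_normE (R : realType) (x : disk_algebra R) : `|x| = ((sup_norm x)%:C)%C.
Proof. by []. Qed.

Lemma disk_algebra_normM (R : realType) (x y : disk_algebra R) : `|x * y| <= `|x| * `|y|.
Proof.
rewrite !disk_algebra_normE -rmorphM lecR.
exact: (sup_normM (cdisk_pt R) (disk_algebra_bounded x) (disk_algebra_bounded y)).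
Qed.

Definition recurrent_vector (K : numFieldType) (X : normedModType K)
    (T : X -> X) (x : X) : Prop :=
  exists k : nat -> nat,
    [/\ forall n, (0 < k n)%N,
        {homo k : m n / (m < n)%N} &
        (fun n => iter (k n) T x) @ \oo --> x].

Definition recurrent_operator (K : numFieldType) (X : normedModType K)
    (T : X -> X) : Prop :=
  forall U : set X, open U -> U !=set0 ->
    exists2 k : nat, (0 < k)%N & U `&` (iter k T @^-1` U) !=set0.

Definition mul_op (A : pzSemiRingType) (a : A) : A -> A := fun x => a * x.

Lemma mul_op_linear (K : pzRingType) (A : algType K) (a : A) :
  linear (mul_op a).
Proof. by move=> k x y; rewrite /mul_op mulrDr scalerAr. Qed.

(* Main.v *)
Require Import Defs.
From HB Require Import structures.
From mathcomp Require Import all_boot all_order all_algebra.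
From mathcomp Require Import complex.
From mathcomp Require Import all_classical all_reals all_analysis.
Set Implicit Arguments.
Unset Strict Implicit.
Unset Printing Implicit Defensive.
Import Order.TTheory GRing.Theory Num.Theory.
Import numFieldNormedType.Exports.
Local Open Scope classical_set_scope.
Local Open Scope ring_scope.

(** If $a^{k_n} b \to b$ uniformly with all $k_n \geq 1$, then wherever
    $b(z) \neq 0$ the powers $a(z)^{k_n}$ tend to 1, which forces $|a(z)| = 1$:
    the positive powers of a modulus other than 1 stay at least as far from 1 as
    that modulus itself ([norm_eq1_of_powers]). A non-zero $b$ is non-zero on
    some open subset of the disk, so there the analytic function $a$ has
    constant modulus 1. By the maximum principle $a$ is constant on that subset,
    and by the identity theorem on the whole disk ([unimodular_constant]). Thus
    $a = \lambda$, and evaluating at one point where $b \neq 0$ shows that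
    powers $\lambda^k$ with $k \geq 1$ come arbitrarily close to 1
    ([recurrent_multiplier_constant]). Therefore every vector $x$ is approached
    by the vectors $\lambda^k x$, and multiplication by $a$ is recurrent
    ([scaling_recurrent]).

    The two algebras differ only on the unit circle. An element of the disk
    algebra is determined by its values in the open disk, by continuity
    ([disk_algebra_constant]); this is used both to find a point of the open
    disk where $b \neq 0$ and to extend $a = \lambda$ to the closed disk.

    The function theory is derived from one estimate, the Taylor remainder bound
    [taylor_remainder]: near an expansion point the first $m$ terms of the
    series approximate the function up to $O(|z - z_0|^m)$. *)

(** * Small positive numbers and geometric sums *)

(** The order on complex numbers is partial, so there is no minimum to take;
    but positive numbers are real, hence pairwise comparable, and finitely many
    smallness conditions can still be met together. *)

Lemma exists_pos_lt (R : realType) (s : seq (Cplx R)) :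
  all (fun x => 0 < x) s -> exists2 t : Cplx R, 0 < t & all (fun x => t < x) s.
Proof.
elim: s => [_|x s IH /= /andP[x0 /IH[t t0 ts]]]; first by exists 1.
have half (y : Cplx R) : 0 < y -> 0 < y / 2 /\ y / 2 < y.
  by move=> y0; rewrite divr_gt0// ltr_pdivrMr// ltr_pMr// ltr1n.
have [hx0 hx] := half _ x0.
have [le|le] : x / 2 <= t \/ t <= x / 2.
  by apply/orP; rewrite real_leVge ?gtr0_real.
- exists (x / 2) => //; rewrite hx; apply/allP => y ys.
  by apply: le_lt_trans le _; exact: (allP ts).
- by exists t => //; rewrite (le_lt_trans le hx).
Qed.

Lemma open_disk_nbhs (R : realType) (z0 : Cplx R) : open_disk R z0 ->
  exists2 d : Cplx R, 0 < d & forall w, `|w| < d -> open_disk R (z0 + w).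
Proof.
move=> z0D; exists (1 - `|z0|); first by rewrite subr_gt0.
move=> w wd; apply: le_lt_trans (ler_normD _ _) _.
by rewrite -ltrBrDl.
Qed.

(** The ratio 1/8 is that of the coefficient bound [analytic_coef_bound]. *)
Lemma sum_geom8_le2 (F : numFieldType) N : \sum_(i < N) 8^-1 ^+ i <= 2 :> F.
Proof.
(* The subtracted term strengthens the bound enough for the induction on N. *)
apply: (@le_trans _ _ (2 - 2 * 8^-1 ^+ N)); last first.
  by rewrite gerBl mulr_ge0// exprn_ge0 ?invr_ge0.
elim: N => [|N IH]; first by rewrite big_ord0 expr0 mulr1 subrr.
rewrite big_ord_recr/=; apply: le_trans (lerD IH (lexx _)) _.
rewrite -addrA lerD2l exprS mulrCA -[X in X <= _]opprK lerN2 opprD opprK.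
set x := _ ^+ N; have x0 : 0 <= x by rewrite exprn_ge0 ?invr_ge0.
rewrite -[X in _ <= _ - X]mul1r -mulrBl mulrA ler_wpM2r//.
rewrite (_ : 2 - 1 = 1); last by rewrite (natrD _ 1 1) addrK.
rewrite mulrC ler_pdivrMr// mul1r ler_nat//.
Qed.

(** * Power series expansions at a point of the disk *)

Section local_theory.
Variables (R : realType) (E : set (Cplx R)).
Local Notation C := (Cplx R).
Hypothesis DE : open_disk R `<=` E.
Implicit Types f : E -> C.

Definition disk_point (z : C) (zD : open_disk R z) : E :=
  exist (fun z => z \in E) z (mem_set (DE zD)).

(** The property bound existentially in [analytic_at], with the coefficients
    exposed. *)
Definition has_expansion f (z0 : C) (c : nat -> C) :=
  exists2 r : C, 0 < r & forall z : E, `|\val z - z0| < r ->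
    series (fun n => c n * (\val z - z0) ^+ n) @ \oo --> f z.

(** On the closed disk of radius d = rho / 8 the terms c_n d^n decay like 8^-n.
    Scaling down by q = |w| / d gains a factor q^n <= q^m in every term of index
    n >= m, so the tail of the series is at most a geometric sum times q^m. *)
Lemma taylor_remainder f z0 c m : open_disk R z0 -> has_expansion f z0 c ->
  exists K d : C, [/\ 0 < K, 0 < d & forall z : E, `|\val z - z0| <= d ->
    `|f z - \sum_(n < m) c n * (\val z - z0) ^+ n| <= K * `|\val z - z0| ^+ m].
Proof.
move=> z0D [r r0 fc].
have [rho [M [rho0 M0 rhor cM]]] := analytic_coef_bound DE z0D r0 fc.
have d0 : 0 < rho / 8 by rewrite divr_gt0.
exists (M * 2 / (rho / 8) ^+ m), (rho / 8).
split => //; first by rewrite divr_gt0 ?exprn_gt0// mulr_gt0.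
move=> z; set w := \val z - z0 => wd.
have wr : `|w| < r.
  apply: le_lt_trans wd _; apply: lt_le_trans rhor.
  by rewrite ltr_pdivrMr// ltr_pMr// ltr1n.
have := fc z wr; rewrite -/w => fz.
set q := `|w| / (rho / 8).
have q0 : 0 <= q by rewrite divr_ge0// ltW.
have q1 : q <= 1 by rewrite ler_pdivrMr// mul1r.
have term n : (m <= n)%N -> `|c n * w ^+ n| <= M * q ^+ m * 8^-1 ^+ n.
  move=> mn; have -> : `|c n * w ^+ n| = `|c n * (rho / 8) ^+ n| * q ^+ n.
    rewrite !normrM !normrX -mulrA; congr (_ * _).
    by rewrite (gtr0_norm d0) -exprMn mulrCA divff ?mulr1// gt_eqF.
  apply: (@le_trans _ _ (M * 8^-1 ^+ n * q ^+ m)); last by rewrite mulrAC.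
  apply: ler_pM => //; first exact: exprn_ge0.
    by apply: cM; rewrite gtr0_norm.
  exact: ler_wiXn2l.
apply/ler_addgt0Pr => e e0.
move/cvgrPdist_lt : fz => /(_ e e0)[N0 _ HN].
(* A partial sum that is e-close to f z and contains the first m terms. *)
pose N := maxn m N0.
have := HN N (leq_maxr _ _); set S := series _ N => /= SN.
rewrite -(subrK S (f z)) -addrA addrC; apply: le_trans (ler_normD _ _) _.
apply: lerD (ltW SN).
have mN : (m <= N)%N by exact: leq_maxl.
rewrite /S /series/= (big_cat_nat _ (n := m))//= big_mkord addrC addrA addNr add0r.
apply: le_trans (ler_norm_sum _ _ _) _.
apply: (@le_trans _ _ (\sum_(m <= n < N) M * q ^+ m * 8^-1 ^+ n)).
  by rewrite big_nat [leRHS]big_nat; apply: ler_sum => n /andP[mn _]; exact: term.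
have pos n : 0 <= M * q ^+ m * 8^-1 ^+ n.
  by rewrite mulr_ge0 ?mulr_ge0 ?exprn_ge0 ?invr_ge0// ltW.
apply: (@le_trans _ _ (\sum_(0 <= n < N) M * q ^+ m * 8^-1 ^+ n)).
  rewrite [leRHS](big_cat_nat _ (n := m))//= lerDr.
  by apply: sumr_ge0 => n _; exact: pos.
rewrite -mulr_sumr big_mkord; apply: (@le_trans _ _ (M * q ^+ m * 2)).
  by rewrite ler_wpM2l ?sum_geom8_le2// mulr_ge0 ?exprn_ge0// ltW.
by rewrite /q expr_div_n mulrAC !mulrA mulrAC.
Qed.

Lemma expansion_center f z0 c (z : E) : open_disk R z0 -> has_expansion f z0 c ->
  \val z = z0 -> f z = c 0%N.
Proof.
move=> z0D fc zz0; have [K [d [K0 d0 /(_ z)]]] := taylor_remainder 1 z0D fc.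
rewrite zz0 subrr normr0 expr0n/= mulr0 big_ord1 expr0 mulr1 => /(_ (ltW d0)).
by rewrite normr_le0 subr_eq0 => /eqP.
Qed.

Lemma expansion_leading f z0 c m : open_disk R z0 -> has_expansion f z0 c ->
  (forall n, (0 < n < m.+1)%N -> c n = 0) ->
  exists K d : C, [/\ 0 < K, 0 < d & forall z : E, `|\val z - z0| <= d ->
    `|f z - (c 0%N + c m.+1 * (\val z - z0) ^+ m.+1)|
      <= K * `|\val z - z0| ^+ m.+2].
Proof.
move=> z0D fc c0; have [K [d [K0 d0 H]]] := taylor_remainder m.+2 z0D fc.
exists K, d; split => // z /H.
rewrite big_ord_recr big_ord_recl/= expr0 mulr1 big1 ?addr0// => i _.
by rewrite c0 ?mul0r//= /bump/= add1n ltnS ltn_ord.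
Qed.

(** Local maximum principle: if c (m+1) were the first non-zero coefficient of
    positive index, then along a suitable ray |f| would exceed |c 0| by
    t^(m+1) |v|, with an error of order t^(m+2) only. *)
Lemma max_modulus f z0 c : open_disk R z0 -> has_expansion f z0 c ->
  (exists2 e : C, 0 < e & forall z : E, `|\val z - z0| < e -> `|f z| <= `|c 0%N|) ->
  forall m, c m.+1 = 0.
Proof.
move=> z0D fc [e e0 fe]; elim/ltn_ind => m IH.
apply/eqP/negP => /negP cm0.
have c_below n : (0 < n < m.+1)%N -> c n = 0.
  by case: n => [//|n] /andP[_ nm]; exact: IH.
have [K [d [K0 d0 H]]] := expansion_leading z0D fc c_below.
have [r r0 rD] := open_disk_nbhs z0D.
(* The values v = c (m+1) * u^(m+1) that point in the same direction as c 0 make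
   c 0 + t^(m+1) * v as long as possible; u exists because every complex number
   has an (m+1)-th root. *)
have [v v0 vE] : exists2 v : C, v != 0 &
    forall t : C, 0 <= t -> `|c 0%N + t * v| = `|c 0%N| + t * `|v|.
  have [->|c0] := eqVneq (c 0%N) 0.
    exists 1; first exact: oner_neq0.
    by move=> t t0; rewrite normr0 !add0r normrM ger0_norm.
  exists (c 0%N) => // t t0; rewrite -{1}(mul1r (c 0%N)) -mulrDl normrM.
  by rewrite (ger0_norm (addr_ge0 ler01 t0)) mulrDl mul1r.
pose u := m.+1.-root (v / c m.+1).
have uE : c m.+1 * u ^+ m.+1 = v by rewrite rootCK// mulrCA divff ?mulr1.
have u0 : 0 < `|u|.
  rewrite normr_gt0; apply: contraNneq v0 => u0.
  by rewrite -uE u0 expr0n mulr0.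
have [|t t0 /and5P[tr td te tK _]] := @exists_pos_lt R
    [:: r / `|u|; d / `|u|; e / `|u|; `|v| / (K * `|u| ^+ m.+2)].
  have v0' : 0 < `|v| by rewrite normr_gt0.
  by rewrite /= !divr_gt0//; apply: mulr_gt0 => //; exact: exprn_gt0.
have nw : `|t * u| = t * `|u| by rewrite normrM gtr0_norm.
have zD : open_disk R (z0 + t * u).
  by apply: rD; rewrite nw -ltr_pdivlMr.
have [z zE] : exists z : E, \val z - z0 = t * u.
  by exists (disk_point zD); rewrite /= addrC addKr.
have := H z; have := fe z.
rewrite zE nw -!ltr_pdivlMr// => /(_ te) fle.
rewrite -ler_pdivlMr// => /(_ (ltW td)).
rewrite (exprMn _ t) mulrCA uE => fle2.
have : `|c 0%N| + t ^+ m.+1 * `|v| - K * (t * `|u|) ^+ m.+2 <= `|c 0%N|.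
  apply: le_trans fle; rewrite lerBlDr -vE; last by rewrite exprn_ge0// ltW.
  rewrite -lerBlDl; apply: le_trans fle2.
  by rewrite distrC; exact: lerB_dist.
rewrite -addrA gerDl subr_le0.
have -> : K * (t * `|u|) ^+ m.+2 = t ^+ m.+1 * (t * (K * `|u| ^+ m.+2)).
  by rewrite exprMn (exprSr t m.+1) mulrCA -mulrA.
rewrite ler_pM2l ?exprn_gt0// -ler_pdivrMr; last first.
  by rewrite mulr_gt0// exprn_gt0.
by move=> /(lt_le_trans tK); rewrite ltxx.
Qed.

(** Contrapositive of the isolation of zeros. At a zero near z0 the first
    non-zero term c_m w^m would have to be compensated by the remainder, giving
    |c_m| <= K |w| for arbitrarily small w. *)
Lemma isolated_zeros f z0 c : open_disk R z0 -> has_expansion f z0 c ->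
  (forall e : C, 0 < e ->
     exists z : E, [/\ 0 < `|\val z - z0|, `|\val z - z0| < e & f z = 0]) ->
  forall m, c m = 0.
Proof.
move=> z0D fc fe; elim/ltn_ind => m IH.
have [K [d [K0 d0 H]]] := taylor_remainder m.+1 z0D fc.
apply/eqP; rewrite -normr_le0; apply/ler_addgt0Pr => e e0; rewrite add0r.
have [|t t0 /and3P[td te _]] := @exists_pos_lt R [:: d; e / K].
  by rewrite /= d0 divr_gt0.
have [z [z0' zt fz]] := fe t t0.
have := H z (ltW (lt_trans zt td)).
rewrite fz sub0r normrN big_ord_recr/= big1 ?add0r => [|i _]; last first.
  by rewrite IH ?mul0r.
rewrite normrM normrX exprS mulrA ler_pM2r ?exprn_gt0// => /le_trans; apply.
by rewrite mulrC -ler_pdivlMr// ltW// (lt_trans zt).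
Qed.

Lemma expansion_eq0 f z0 c : has_expansion f z0 c -> (forall m, c m = 0) ->
  exists2 e : C, 0 < e & forall z : E, `|\val z - z0| < e -> f z = 0.
Proof.
move=> [r r0 fc] c0; exists r => // z /fc.
have -> : series (fun n => c n * (\val z - z0) ^+ n) = fun=> 0.
  by apply/funext => n; rewrite /series/= big1// => i _; rewrite c0 mul0r.
by move=> h; apply: cvg_unique h _; [exact: norm_hausdorff|exact: cvg_cst].
Qed.

(** The zero set is propagated along the segment from z0 to z. Let T be the
    supremum of the times up to which f vanishes on the segment. The zeros just
    before time T accumulate at the point reached at T, so f vanishes around
    that point, which is a contradiction unless T = 1. Working on a segment
    avoids re-expanding a power series at a new centre. *)
Lemma identity_theorem f z0 : disk_analytic f -> open_disk R z0 ->
  (exists2 e : C, 0 < e & forall z : E, `|\val z - z0| < e -> f z = 0) ->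
  forall z : E, open_disk R (\val z) -> f z = 0.
Proof.
move=> fa z0D [e0 e0_gt0 f0] z z1D; set z1 := \val z in z1D.
have [z10|z10] := eqVneq z1 z0.
  by apply: f0; rewrite -/z1 z10 subrr normr0.
pose h := z1 - z0; have h0 : 0 < `|h| by rewrite normr_gt0 subr_eq0.
pose g (t : R) : C := z0 + (t%:C)%C * h.
have gD t : 0 <= t <= 1 -> open_disk R (g t).
  move=> /andP[t0 t1].
  have -> : g t = ((1 - t)%:C)%C * z0 + (t%:C)%C * z1.
    by rewrite /g /h rmorphB/= mulrBl mul1r mulrBr addrCA addrC addrAC.
  apply: le_lt_trans (ler_normD _ _) _; rewrite !normrM.
  rewrite (ger0_norm (_ : 0 <= ((1 - t)%:C)%C)); last by rewrite ler0c subr_ge0.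
  rewrite (ger0_norm (_ : 0 <= (t%:C)%C)) ?ler0c//.
  have [->|tn0] := eqVneq t 0.
    by rewrite subr0 !mul1r mul0r addr0.
  apply: (@lt_le_trans _ _ (((1 - t)%:C)%C + (t%:C)%C)); last first.
    by rewrite -rmorphD subrK.
  apply: ler_ltD; first by rewrite ler_piMr ?ler0c ?subr_ge0// ltW.
  by rewrite gtr_pMr// (ltcR 0) lt_neqAle eq_sym tn0.
have gB s t : `|g s - g t| = (`|s - t|%:C)%C * `|h|.
  have -> : g s - g t = ((s - t)%:C)%C * h.
    by rewrite /g opprD addrACA subrr add0r -mulrBl rmorphB.
  by rewrite normrM normc_def/= expr0n/= addr0 sqrtr_sqr.
pose S : set R := [set t | 0 <= t <= 1 /\
  forall s, 0 <= s <= t -> forall y : E, \val y = g s -> f y = 0].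
have S0 : S 0.
  split; rewrite ?lexx ?ler01// => s; rewrite -eq_le => /eqP <- y yg.
  by apply: f0; rewrite yg /g mul0r addr0 subrr normr0.
have S1 : ubound S 1 by move=> t [/andP[]].
have supS : has_sup S by split; [exists 0|exists 1].
pose T := sup S.
have T0 : 0 <= T by apply: ub_le_sup => //; exists 1.
have T1 : T <= 1 by apply: ge_sup => //; exists 0.
have below s : 0 <= s < T -> forall y : E, \val y = g s -> f y = 0.
  move=> /andP[s0 sT]; have [|t [_ tS] st] := @sup_gt R S s _ sT; first by exists 0.
  by apply: tS; rewrite s0 ltW.
have TD : open_disk R (g T) by apply: gD; rewrite T0 T1.
(* At T = 0 nothing precedes T, and the vanishing near z0 is used instead. *)
have [e e_gt0 fe] : exists2 e : C, 0 < e &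
    forall y : E, `|\val y - g T| < e -> f y = 0.
  have [T00|TN0] := eqVneq T 0.
    by exists e0 => //; rewrite T00 /g mul0r addr0.
  have Tgt0 : 0 < T by rewrite lt_neqAle eq_sym TN0.
  have [c [r [r0 fc]]] := fa _ TD.
  have fexp : has_expansion f (g T) c by exists r.
  apply: expansion_eq0 (fexp) _; apply: isolated_zeros TD fexp _ => e e_gt0.
  have [x x0 xE] := C_real_pos (divr_gt0 e_gt0 h0).
  pose s := Num.max 0 (T - x / 2).
  have x2 : 0 < x / 2 by rewrite divr_gt0.
  have s0 : 0 <= s by rewrite le_max lexx.
  have sT : s < T by rewrite gt_max Tgt0 gtrBl.
  have sD : open_disk R (g s) by apply: gD; rewrite s0 (le_trans (ltW sT)).
  exists (disk_point sD); rewrite /= gB ltr0_norm ?subr_lt0// opprB; split.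
  - by rewrite mulr_gt0// (ltcR 0) subr_gt0.
  - rewrite -ltr_pdivlMr// xE ltcR; apply: (@le_lt_trans _ _ (x / 2)).
      by rewrite lerBlDl -lerBlDr le_max lexx orbT.
    by rewrite ltr_pdivrMr// ltr_pMr// ltr1n.
  - by apply: (below s); rewrite ?s0.
have [T1'|TN1] := eqVneq T 1.
  apply: fe; rewrite (_ : g T = z1) ?subrr ?normr0//.
  by rewrite T1' /g mul1r addrC subrK.
have Tlt1 : T < 1 by rewrite lt_neqAle TN1.
have [x x0 xE] := C_real_pos (divr_gt0 e_gt0 h0).
pose t := Num.min 1 (T + x / 2).
have x2 : 0 < x / 2 by rewrite divr_gt0.
have tT : T < t by rewrite lt_min Tlt1 ltrDl.
suff /(ub_le_sup (ex_intro _ 1 S1)) : S t by rewrite leNgt tT.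
split; first by rewrite (le_trans T0 (ltW tT)) ge_min lexx.
move=> s /andP[s0 st] y ys; have [sT|Ts] := ltP s T.
  by apply: (below s) ys; rewrite s0.
apply: fe; rewrite ys gB ger0_norm ?subr_ge0// -ltr_pdivlMr// xE ltcR.
apply: (@le_lt_trans _ _ (x / 2)).
  by rewrite lerBlDl (le_trans st)// ge_min lexx orbT.
by rewrite ltr_pdivrMr// ltr_pMr// ltr1n.
Qed.

Lemma unimodular_constant f z0 : disk_analytic f -> open_disk R z0 ->
  (exists2 e : C, 0 < e & forall z : E, `|\val z - z0| < e -> `|f z| = 1) ->
  exists2 lam : C, `|lam| = 1 & forall z : E, open_disk R (\val z) -> f z = lam.
Proof.
move=> fa z0D [e e0 f1]; have [c [r [r0 fc]]] := fa _ z0D.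
have fexp : has_expansion f z0 c by exists r.
have fz0 : f (disk_point z0D) = c 0%N by apply: expansion_center fexp _.
have c1 : `|c 0%N| = 1 by rewrite -fz0 f1//= subrr normr0.
exists (c 0%N) => // z zD; apply/eqP; rewrite -subr_eq0; apply/eqP.
have gE (y : E) : (1 *: f + (fun=> - c 0%N) : E -> C) y = f y - c 0%N.
  by rewrite -[in RHS](mul1r (f y)).
rewrite -gE; apply: (identity_theorem _ z0D _ zD).
  by apply: disk_analytic_lin fa _ => y _; exact: analytic_cst.
have cS m : c m.+1 = 0.
  apply: (max_modulus z0D fexp _ m); exists e => // y /f1 ->.
  by rewrite c1.
exists r => // y yr; rewrite gE; apply/eqP; rewrite subr_eq0; apply/eqP.
apply: cvg_unique (fc y yr) _; first exact: norm_hausdorff.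
apply: cvg_near_cst; exists 1%N => // -[//|n] _.
rewrite /series/= big_nat_recl//= expr0 mulr1 big1 ?addr0// => i _.
by rewrite cS mul0r.
Qed.

End local_theory.

(** * From recurrence to constant multipliers *)

(** For k >= 1 the number r^k lies on the same side of 1 as r = |x|, and at
    least as far from it; hence |y - x^k y| >= |1 - r| |y|, which would be a
    positive lower bound if r were not 1. *)
Lemma norm_eq1_of_powers (K : numFieldType) (x y : K) : y != 0 ->
  (forall e : K, 0 < e -> exists2 k : nat, (0 < k)%N & `|y - x ^+ k * y| < e) ->
  `|x| = 1.
Proof.
move=> y0 xk; apply/eqP/negP => /negP x1.
have [|k k0] := xk (`|1 - `|x| | * `|y|).
  by rewrite mulr_gt0 ?normr_gt0// subr_eq0 eq_sym.
rewrite -[X in `|X - _|]mul1r -mulrBl normrM ltr_pM2r ?normr_gt0//.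
apply/negP; rewrite -real_leNgt//.
apply: (@le_trans _ _ `|1 - `|x| ^+ k|); last first.
  by rewrite -normrX -{1}(normr1 K); exact: ler_dist_dist.
have [xle|xle] : `|x| <= 1 \/ 1 <= `|x|.
  by apply/orP; rewrite real_leVge ?normr_real ?real1.
- have xkx : `|x| ^+ k <= `|x| by rewrite -[leRHS]expr1 ler_wiXn2l.
  rewrite (@ger0_norm _ (1 - `|x|)) ?subr_ge0//.
  rewrite (@ger0_norm _ (1 - `|x| ^+ k)) ?subr_ge0 ?(le_trans xkx)//.
  by rewrite lerD2l lerN2.
- have xkx : `|x| <= `|x| ^+ k by rewrite -[leLHS]expr1 ler_weXn2l.
  rewrite (@ler0_norm _ (1 - `|x|)) ?subr_le0//.
  rewrite (@ler0_norm _ (1 - `|x| ^+ k)) ?subr_le0 ?(le_trans xle)//.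
  by rewrite lerN2 lerD2l lerN2.
Qed.

Definition powers_return (K : numFieldType) (lam : K) :=
  forall e : K, 0 < e -> exists2 k : nat, (0 < k)%N & `|1 - lam ^+ k| < e.

Lemma scaling_recurrent (K : numFieldType) (X : normedModType K) (T : X -> X)
    (lam : K) :
  (forall x, T x = lam *: x) -> powers_return lam -> recurrent_operator T.
Proof.
move=> Tlam ret U oU [x Ux].
have iterT k : iter k T x = lam ^+ k *: x.
  by elim: k => [|k IH]; rewrite ?scale1r// iterS Tlam IH scalerA exprS.
have /nbhs_ballP[e e0 eU] : nbhs x U by exact: open_nbhs_nbhs.
have x1 : 0 < `|x| + 1 by rewrite ltr_wpDl.
have [|k k0 ke] := ret (e / (`|x| + 1)); first by rewrite divr_gt0.
exists k => //; exists x; split => //=; apply: eU.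
rewrite -ball_normE/= iterT -{1}(scale1r x) -scalerBl normrZ.
rewrite ltr_pdivlMr// in ke; apply: le_lt_trans ke.
by rewrite ler_wpM2l// lerDl.
Qed.

(** The normed space X is left abstract, and its elements are seen as functions
    through ev, so that both algebras are covered: all that matters is that the
    norm dominates the values and that T acts as multiplication by a. *)
Lemma recurrent_multiplier_constant (R : realType) (E : set (Cplx R))
    (X : normedModType (Cplx R)) (T : X -> X) (ev : X -> E -> Cplx R)
    (a : E -> Cplx R) (b : X) :
  open_disk R `<=` E ->
  (forall x y z, ev (x - y) z = ev x z - ev y z) ->
  (forall x z, `|ev x z| <= `|x|) ->
  (forall x z, ev (T x) z = a z * ev x z) ->
  disk_analytic a -> disk_analytic (ev b) ->
  (exists2 z : E, open_disk R (\val z) & ev b z != 0) ->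
  recurrent_vector T b ->
  exists2 lam, forall z : E, open_disk R (\val z) -> a z = lam &
    powers_return lam.
Proof.
move=> DE evB ev_le evT aa ba [z zD bz0] [k [k0 _ kb]].
have ret (y : E) (e : Cplx R) : 0 < e ->
    exists2 n, (0 < n)%N & `|ev b y - a y ^+ n * ev b y| < e.
  move=> e0; move/cvgrPdist_lt : kb => /(_ e e0)[N _ /(_ N (leqnn N))/= bN].
  exists (k N) => //; apply: le_lt_trans bN; apply: le_trans (ev_le _ y).
  rewrite evB; suff -> : ev (iter (k N) T b) y = a y ^+ k N * ev b y by [].
  elim: (k N) => [|n IH]; first by rewrite mul1r.
  by rewrite iterS evT IH exprS mulrA.
have [c [r [r0 bc]]] := ba _ zD.
have bexp : has_expansion (ev b) (\val z) c by exists r.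
have bc0 : ev b z = c 0%N by apply: expansion_center bexp _.
have [K [d [K0 d0 bK]]] := taylor_remainder DE 1 zD bexp.
(* At distance less than |b z| / K from z the values of b cannot reach 0. *)
have [|e e0 /and3P[ed eK _]] :=
    @exists_pos_lt R [:: d; `|ev b z| / K].
  by rewrite /= d0 divr_gt0// normr_gt0.
have b_near (y : E) : `|\val y - \val z| < e -> ev b y != 0.
  move=> ye; apply/eqP => by0.
  have := bK y (ltW (lt_trans ye ed)).
  rewrite by0 sub0r normrN big_ord1 expr0 mulr1 -bc0 expr1 => bKy.
  have := lt_trans ye eK; rewrite ltr_pdivlMr// mulrC => /(le_lt_trans bKy).
  by rewrite ltxx.
have [|lam lam1 alam] := unimodular_constant DE aa zD.
  by exists e => // y /b_near by0; apply: norm_eq1_of_powers by0 (ret y).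
exists lam => // e' e'0; have bz : 0 < `|ev b z| by rewrite normr_gt0.
have [|n n0] := ret z (e' * `|ev b z|); first by rewrite mulr_gt0.
rewrite alam// -[X in `|X - _|]mul1r -mulrBl normrM ltr_pM2r// => ne.
by exists n.
Qed.

(** Every point z of the closed disk is a limit of points (1 - s) z of the open
    disk. *)
Lemma disk_algebra_constant (R : realType) (f : disk_algebra R) (lam : Cplx R) :
  (forall z : closed_disk R, open_disk R (\val z) -> f z = lam) ->
  forall z, f z = lam.
Proof.
case: f => f /= /asboolP[_ fc] flam z.
move/subspace_valL_continuousP/subspace_continuousP : fc.
move=> /(_ (\val z) (set_valP z)) /cvgrPdist_lt fz.
have z1 : `|\val z| <= 1 by exact: (set_valP z).
have vE (y : closed_disk R) : valL f (\val y) = f y.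
  by rewrite -[in RHS](valLK point f).
apply/eqP; rewrite -subr_eq0 -normr_le0; apply/ler_addgt0Pr => e e0.
rewrite add0r; have /nbhs_ballP[d d0 fd] := fz e e0.
have [|s s0 /and3P[sd s1 _]] := @exists_pos_lt R [:: d; 1]; first by rewrite /= d0 ltr01.
have s10 : 0 < 1 - s by rewrite subr_gt0.
have yD : open_disk R ((1 - s) * \val z).
  rewrite /open_disk/= normrM gtr0_norm//; apply: le_lt_trans (_ : _ <= 1 - s) _.
    by rewrite ler_piMr// ltW.
  by rewrite gtrBl.
pose y : closed_disk R := disk_point (@open_closed_disk R) yD.
have near_z : `|(\val z : Cplx R) - \val y| < d -> `|f z - f y| < e.
  rewrite -!vE => zy; apply: (fd (\val y)); last exact: set_valP.
  by rewrite -ball_normE.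
rewrite -(flam y)//; apply/ltW/near_z.
rewrite /= mulrBl mul1r opprB addrCA subrr addr0 normrM gtr0_norm//.
by apply: le_lt_trans sd; rewrite ler_piMr// ltW.
Qed.

Theorem corollary2p10 (R : realType) :
  (forall a b : disk_algebra R,
    b != 0 -> recurrent_vector (mul_op a) b ->
    recurrent_operator (mul_op a)) /\
  (forall a b : Hinf R,
    b != 0 -> recurrent_vector (mul_op a) b ->
    recurrent_operator (mul_op a)).
Proof.
split=> a b b0 rec.
- have [lam alam ret] : exists2 lam, forall z : closed_disk R,
      open_disk R (\val z) -> a z = lam & powers_return lam.
    apply: (@recurrent_multiplier_constant R (closed_disk R) (disk_algebra R)
      (mul_op a) (@disk_algebra_fun R) a b) rec => //.
    + exact: open_closed_disk.
    + move=> x z; rewrite disk_algebra_normE.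
      exact: sup_norm_ub (disk_algebra_bounded x).
    + by case: a => f /= /asboolP[].
    + by case: b {b0} => f /= /asboolP[].
    + apply: contrapT => bz; case/eqP: b0; apply: val_inj; apply/funext => z.
      apply: disk_algebra_constant => y yD; apply/eqP/negP => /negP by0.
      by apply: bz; exists y.
  apply: scaling_recurrent ret => x; apply: val_inj; apply/funext => z.
  have az := disk_algebra_constant alam z.
  by rewrite -az.
- have memD (z : open_disk R) : open_disk R (\val z) by exact: (set_valP z).
  have [lam alam ret] : exists2 lam, forall z : open_disk R,
      open_disk R (\val z) -> a z = lam & powers_return lam.
    apply: (@recurrent_multiplier_constant R (open_disk R) (Hinf R)
      (mul_op a) (@Hinf_fun R) a b) rec => //.
    + move=> x z; rewrite Hinf_normE.
      exact: sup_norm_ub (Hinf_bounded x).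
    + by case: a => f /= /asboolP[].
    + by case: b {b0} => f /= /asboolP[].
    + apply: contrapT => bz; case/eqP: b0; apply: val_inj; apply/funext => z.
      apply/eqP/negP => /negP by0.
      by apply: bz; exists z.
  apply: scaling_recurrent ret => x; apply: val_inj; apply/funext => z.
  by rewrite -(alam z).
Qed.
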